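(* Let $G_D$ be a data tensor network in which each vertex is adjacent to an edge in $\bar E$ (the set of edges to be sketched), and let $T_0$ be a given contraction tree of $G_D$. Then the asymptotic cost of the Sketching Algorithm on $(G_D,T_0)$ is optimal with respect to the optimization problem $$\min_{G_E}\ \min_{T_B}\ C(T_B)\quad\text{s.t. } G_E\in\mathcal G^{(\epsilon,\delta)},\ \ T_B \text{ a contraction tree of } (G_D,G_E)\text{ constrained on } T_0,$$ i.e. if $c$ is the cost of the Sketching Algorithm and $c_{\mathrm{opt}}$ is the optimal value of this problem, then $c=O(c_{\mathrm{opt}})$.
   Context: **Tensor networks.** A tensor network is an undirected hypergraph $G=(V,E,w)$: each vertex is a tensor, each hyperedge a tensor dimension, $w(e)\ge0$ the natural log of the dimension size. A hyperedge is uncontracted if it has a dangling end (not adjacent to a vertex), and contracted otherwise (adjacent to at least two vertices). **Data and embedding.** The data $G_D=(V_D,E_D,w)$ is a hypergraph tensor network with a set $\bar E=\{e_1,\dots,e_N\}\subseteq E_D$ of uncontracted edges to be sketched; $e_j$ is adjacent to exactly one vertex $v_j\in V_D$, the $v_j$ are distinct, and $s_j=\exp(w(e_j))$. An embedding is a graph tensor network $G_E=(V_E,E_E,w)$, $N_E=|V_E|$, with $\bar E\subseteq E_E$: in the combined network $e_j$ joins $v_j$ to an embedding vertex; the other edges of $E_E$ join two embedding vertices (parallel edges allowed) or are uncontracted output edges $E_1\subset E_E$ adjacent to one embedding vertex. The sketch size is $m=\exp(\sum_{e\in E_1}w(e))$. Standing assumption: each $s_j>m$. The combined network is $G=(V,E,w)$,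 $V=V_E\cup V_D$, $E=E_E\cup E_D$; also $L=(V,E_E,w)$, $R=(V,E\setminus E_E,w)$. **Cuts and cost.** For a (hyper)graph $H$ on $V$ and disjoint $A,B\subseteq V$: $\mathrm{cut}_H(A,B)$ is the total weight of hyperedges adjacent to both $A$ and $B$; $\mathrm{cut}_H(A,* )$ the total weight of uncontracted hyperedges adjacent only to vertices of $A$; $\mathrm{cut}_H(A)=\mathrm{cut}_H(A,V\setminus A)+\mathrm{cut}_H(A,* )$. $\mathrm{cost}_H(A,B)=\mathrm{cut}_H(A)+\mathrm{cut}_H(B)-\mathrm{cut}_H(A,B)$. **Contraction trees.** A contraction tree of a network on $V$ is a rooted binary tree whose vertices are subsets of $V$, leaves are singletons, the root is $V$, and each internal vertex $W$ is the disjoint union of its children $W_1,W_2$ (the contraction $(W_1,W_2)$). Contracting $(W_1,W_2)$ costs $\exp(\mathrm{cost}_G(W_1,W_2))$ (classical dense matrix multiplication), and $C(T_B)$ is the sum over all contractions. $T_B$ for $(G_D,G_E)$ is constrained on $T_0$ (a contraction tree of $G_D$) if for each $(A,B)\in T_0$ there is $(\hat A,\hat B)\in T_B$ with $\hat A\cap V_D=A$, $\hat B\cap V_D=B$. $O,\Omega,\Theta$ hide absolute constants. **Class $\mathcal G^{(\epsilon,\delta)}$.** A sketching linearization $G_S$ is obtained by choosing an ordering of $V$ in which data vertices precede embedding vertices, and directing every contracted edge of $L$ to its higher-indexed endpoint and every uncontracted edge outward; $\mathrm{cut}_{G_S}(v)$ is the total weight of edges leaving $v$ (including outward dangling ones).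 $\mathcal G^{(\epsilon,\delta)}$ is the set of Gaussian embeddings (independent tensors with i.i.d. normalized Gaussian entries) with $|E_1|=1$, $m=\Theta(N_E\log(1/\delta)/\epsilon^2)$, for which some sketching linearization has effective sketch dimension of size $\Omega(N_E\log(1/\delta)/\epsilon^2)$ at each embedding vertex, taken as $\mathrm{cut}_{G_S}(v)\ge\log m$ for all $v\in V_E$. **Notation for $T_0$.** Write a topological order of $T_0$ as $(U_1,V_1),\dots,(U_{N_D-1},V_{N_D-1})$, $N_D=|V_D|$, and let $a_i=\exp(\mathrm{cut}_R(U_i)-\mathrm{cut}_R(U_i,V_i))$, $c_i=\exp(\mathrm{cut}_R(V_i)-\mathrm{cut}_R(U_i,V_i))$, $d_i=\exp(\mathrm{cut}_R(U_i\cup V_i))/(a_ic_i)$, $b_i=\exp(\mathrm{cut}_R(U_i,V_i))/d_i$. In the present case (each data vertex adjacent to an edge of $\bar E$, so $N=N_D$) every contraction has both $U_i$ and $V_i$ adjacent to $\bar E$. **Sketching Algorithm** (in the present case), with $m=\Theta(N\log(1/\delta)/\epsilon^2)$. (1) Each $v_j$ is contracted with a Gaussian $s_j\times m$ matrix along $e_j$. (2) Going through $(U_i,V_i)$ in order, let $\hat U_i,\hat V_i$ be the already sketched versions of $U_i,V_i$, each carrying sketched dimension of total size $m$. Sketch $(\hat U_i,\hat V_i)$ with a small network of two Gaussian tensors. If $a_i\le c_i$: tensor $z_1$ is connected to $\hat U_i$ (total size $m$), to $\hat V_i$ (size $\alpha$) and to a tensor $z_2$ (size $m$); $z_2$ is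 also connected to $\hat V_i$ (size $m/\alpha$) and has an output of size $m$; the contraction order is $(((\hat U_i,z_1),\hat V_i),z_2)$ and $\alpha\in[1,m]$ is chosen to minimize its cost (i.e. $\sqrt{c_im/b_i}$ truncated to $[1,m]$). If $a_i>c_i$: the same with the roles of $(\hat U_i,a_i)$ and $(\hat V_i,c_i)$ exchanged. The sketched dimension of $\hat V_i$ (resp. $\hat U_i$) is split into two parallel edges of sizes $\alpha$, $m/\alpha$; integrality of sizes is ignored. The output replaces the contraction output of $(U_i,V_i)$. The cost of the algorithm is the total cost of all these contractions.
   Formalization: The embeddings compared are limited to those whose sketch size is at least a constant fraction of the algorithm's m (in effect N = O(N_E)); with N_E unrestricted the claim fails, since a 3-vertex embedding can have a far smaller sketch size. *)

(* Defs.v *)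
From HB Require Import structures.
From mathcomp Require Import all_boot all_order all_algebra.
From mathcomp Require Import boolp classical_sets reals ereal sequences exp.
Set Implicit Arguments.
Unset Strict Implicit.
Unset Printing Implicit Defensive.
Import Order.TTheory GRing.Theory Num.Theory.
Local Open Scope ring_scope.

(* The weight of an edge is the natural logarithm of its dimension size; sizes
   are arbitrary reals >= 1 (integrality is ignored).  A [dangling] edge is an
   uncontracted one.  An uncontracted hyperedge may be adjacent to several
   vertices in addition to its dangling end. *)
Record network (R : realType) (V E : finType) := Network {
  ends : E -> {set V};
  dangling : E -> bool;
  wt : E -> R }.

Section Cuts.
Variables (R : realType) (V E : finType) (G : network R V E).

Definition wf_network : Prop := forall e : E,
  [/\ 0 <= wt G e, (0 < #|ends G e|)%N &
      (~~ dangling G e -> (1 < #|ends G e|)%N)].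

(* In the cuts below, [H : {set E}] stands for the sub-hypergraph (V, H, w). *)
Definition cut_between (H : {set E}) (A B : {set V}) : R :=
  \sum_(e in H | (ends G e :&: A != finset.set0) &&
                 (ends G e :&: B != finset.set0)) wt G e.

Definition cut_dangling (H : {set E}) (A : {set V}) : R :=
  \sum_(e in H | dangling G e && (ends G e \subset A)) wt G e.

Definition cut_weight (H : {set E}) (A : {set V}) : R :=
  cut_between H A (~: A) + cut_dangling H A.

Definition contraction_cost (H : {set E}) (A B : {set V}) : R :=
  cut_weight H A + cut_weight H B - cut_between H A B.

End Cuts.

Inductive ctree (V : Type) := Leaf of V | Node of ctree V & ctree V.
Arguments Leaf {V}.
Arguments Node {V}.

Section Trees.
Variable V : finType.

Fixpoint leaves (T : ctree V) : {set V} :=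
  match T with
  | Leaf v => [set v]%SET
  | Node T1 T2 => leaves T1 :|: leaves T2
  end.

(* Children precede their parents, so this is a topological order. *)
Fixpoint contractions (T : ctree V) : seq ({set V} * {set V}) :=
  match T with
  | Leaf _ => [::]
  | Node T1 T2 =>
      contractions T1 ++ contractions T2 ++ [:: (leaves T1, leaves T2)]
  end.

Definition is_contraction_tree (T : ctree V) : Prop :=
  all (fun c : {set V} * {set V} => [disjoint c.1 & c.2]) (contractions T) /\
  leaves T = [set: V]%SET.

End Trees.

Definition tree_cost (R : realType) (V E : finType) (G : network R V E)
    (T : ctree V) : R :=
  \sum_(c <- contractions T)
     expR (contraction_cost G [set: E]%SET c.1 c.2).

(* [Ebar] is the set of edges to be sketched; v_j is the only element of
   [ends D e_j], and the injectivity says that the v_j are distinct. *)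
Definition sketchable (R : realType) (VD ED : finType) (D : network R VD ED)
    (Ebar : {set ED}) : Prop :=
  [/\ wf_network D,
      {in Ebar, forall e, dangling D e /\ #|ends D e| = 1%N} &
      {in Ebar &, injective (ends D)}].

(* [sketcher e] is the embedding vertex joined to the data by [e]; only its
   values on the edges to be sketched are used.  [inner] holds the other edges
   of E_E. *)
Record embedding (R : realType) (ED VE F : finType) := Embedding {
  sketcher : ED -> VE;
  inner : network R VE F }.

Section Embedding.
Variables (R : realType) (VD ED VE F : finType).
Variables (D : network R VD ED) (Ebar : {set ED}) (Em : embedding R ED VE F).

Definition wf_embedding : Prop := forall f : F,
  0 <= wt (inner Em) f /\
  #|ends (inner Em) f| = (if dangling (inner Em) f then 1 else 2)%N.

(* E_1 *)
Definition output_edges : {set F} := [set f | dangling (inner Em) f]%SET.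

Definition sketch_size : R := expR (\sum_(f in output_edges) wt (inner Em) f).

Definition combined : network R (VD + VE)%type (ED + F)%type := {|
  ends := fun x => match x with
    | inl e => (inl @: ends D e) :|:
               (if e \in Ebar then [set inr (sketcher Em e)]%SET
                else finset.set0)
    | inr f => inr @: ends (inner Em) f
    end;
  dangling := fun x => match x with
    | inl e => dangling D e && (e \notin Ebar)
    | inr f => dangling (inner Em) f
    end;
  wt := fun x => match x with
    | inl e => wt D e
    | inr f => wt (inner Em) f
    end |}.

(* E_E, the edge set of the subgraph L *)
Definition embedding_edges : {set (ED + F)%type} :=
  [set x | match x with inl e => e \in Ebar | inr _ => true end]%SET.

(* An ordering of the vertices in which the data precede the embedding. *)
Definition sketching_order (rk : (VD + VE)%type -> nat) : Prop :=
  injective rk /\ forall v u, (rk (inl v) < rk (inr u))%N.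

(* cut_{G_S}(v): every contracted edge of L is directed to its endpoint of
   higher rank, every uncontracted one outward. *)
Definition outgoing (rk : (VD + VE)%type -> nat) (v : (VD + VE)%type) : R :=
  \sum_(e in embedding_edges |
          (v \in ends combined e) &&
          (dangling combined e ||
           [exists u in ends combined e, (rk v < rk u)%N])) wt combined e.

End Embedding.

Definition theta (R : realType) (lo up x y : R) : Prop := lo * y <= x <= up * y.

(* The class of embeddings for the data [D].  In a Gaussian embedding the
   tensors are independent with i.i.d. normalized Gaussian entries, so its
   distribution is determined by its network, and so are all the costs: the
   class is a class of networks. *)
Definition in_class (R : realType) (lo up eps delta : R)
    (VD ED VE F : finType) (D : network R VD ED) (Ebar : {set ED})
    (Em : embedding R ED VE F) : Prop :=
  [/\ wf_embedding Em,
      #|output_edges Em| = 1%N,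
      theta lo up (sketch_size Em) (#|VE|%:R * ln (1 / delta) / eps ^+ 2) &
      exists rk : (VD + VE)%type -> nat, sketching_order rk /\
        forall v : VE, ln (sketch_size Em) <= outgoing D Ebar Em rk (inr v)].

(* The two children of a tree vertex are not ordered. *)
Definition constrained (VD VE : finType) (T0 : ctree VD)
    (TB : ctree (VD + VE)%type) : Prop :=
  forall A B, (A, B) \in contractions T0 ->
    exists2 c, c \in contractions TB &
      (inl @^-1: c.1 = A /\ inl @^-1: c.2 = B) \/
      (inl @^-1: c.2 = A /\ inl @^-1: c.1 = B).

(* The optimal value, as an infimum (+oo if no embedding is admissible), over
   the embeddings of the class whose sketch size [m_E] satisfies the standing
   assumption [s_j > m_E] and is not of smaller order than [m], the sketch size
   of the algorithm: [m <= k * m_E].  Without the last condition the embeddings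
   compared with the algorithm could have far fewer tensors than edges to be
   sketched, hence a much smaller sketch size. *)
Definition optimal_cost (R : realType) (lo up k eps delta m : R)
    (VD ED : finType) (D : network R VD ED) (Ebar : {set ED})
    (T0 : ctree VD) : \bar R :=
  ereal_inf [set x : \bar R |
    exists (VE F : finType) (Em : embedding R ED VE F)
           (TB : ctree (VD + VE)%type),
      [/\ in_class lo up eps delta D Ebar Em /\
            {in Ebar, forall e, sketch_size Em < expR (wt D e)},
          m <= k * sketch_size Em,
          is_contraction_tree TB,
          constrained T0 TB &
          x = (tree_cost (combined D Ebar Em) TB)%:E]]%classic.

(* The network with the listed edges (endpoints, dangling?, weight). *)
Definition network_of (R : realType) (V : finType)
    (s : seq ({set V} * bool * R)) : network R V 'I_(size s) := {|
  ends := fun i => (tnth (in_tuple s) i).1.1;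
  dangling := fun i => (tnth (in_tuple s) i).1.2;
  wt := fun i => (tnth (in_tuple s) i).2 |}.

Section Algorithm.
Variables (R : realType) (VD ED : finType) (D : network R VD ED).
Variables (Ebar : {set ED}) (m : R).

(* On sets of data vertices, the cuts of R = (V, E \ E_E, w). *)
Definition cutR (A : {set VD}) : R := cut_weight D (~: Ebar) A.
Definition cutR_between (A B : {set VD}) : R := cut_between D (~: Ebar) A B.

(* Step 1: the vertex adjacent to [e], all of whose dimensions other than [e]
   are gathered in one, is contracted with an s x m matrix. *)
Definition matrix_step_cost (e : ED) : R :=
  let v : 'I_2 := @Ordinal 2 0 isT in
  let g : 'I_2 := @Ordinal 2 1 isT in
  tree_cost
    (network_of [:: ([set v]%SET,    true,  cutR (ends D e));
                    ([set v; g]%SET, false, wt D e);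
                    ([set g]%SET,    true,  ln m)])
    (Node (Leaf v) (Leaf g)).

(* Step 2: [p] and [q] are the two sketched tensors, with dimensions of sizes
   [a] (on [p] only), [c] (on [q] only), [b] (contracted between them), [d]
   (shared, not contracted by (p, q)), and sketched dimensions of total size
   [m] each, the one of [q] being split into [alpha] and [m / alpha]. *)
Definition small_network_cost (a b c d alpha : R) : R :=
  let p  : 'I_4 := @Ordinal 4 0 isT in
  let q  : 'I_4 := @Ordinal 4 1 isT in
  let z1 : 'I_4 := @Ordinal 4 2 isT in
  let z2 : 'I_4 := @Ordinal 4 3 isT in
  tree_cost
    (network_of [:: ([set p]%SET,      true,  ln a);
                    ([set q]%SET,      true,  ln c);
                    ([set p; q]%SET,   false, ln b);
                    ([set p; q]%SET,   true,  ln d);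
                    ([set p; z1]%SET,  false, ln m);
                    ([set q; z1]%SET,  false, ln alpha);
                    ([set q; z2]%SET,  false, ln (m / alpha));
                    ([set z1; z2]%SET, false, ln m);
                    ([set z2]%SET,     true,  ln m)])
    (Node (Node (Node (Leaf p) (Leaf z1)) (Leaf q)) (Leaf z2)).

(* The minimizer of [small_network_cost a b c d] over [1, m]. *)
Definition best_alpha (b c : R) : R :=
  Num.min m (Num.max 1 (Num.sqrt (c * m / b))).

Definition size_a (U W : {set VD}) : R := expR (cutR U - cutR_between U W).
Definition size_c (U W : {set VD}) : R := expR (cutR W - cutR_between U W).
Definition size_d (U W : {set VD}) : R :=
  expR (cutR (U :|: W)) / (size_a U W * size_c U W).
Definition size_b (U W : {set VD}) : R :=
  expR (cutR_between U W) / size_d U W.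

Definition contraction_step_cost (U W : {set VD}) : R :=
  let a := size_a U W in let b := size_b U W in
  let c := size_c U W in let d := size_d U W in
  if a <= c then small_network_cost a b c d (best_alpha b c)
  else small_network_cost c b a d (best_alpha b a).

Definition algorithm_cost (T0 : ctree VD) : R :=
  \sum_(e in Ebar) matrix_step_cost e +
  \sum_(c <- contractions T0) contraction_step_cost c.1 c.2.

End Algorithm.

(* Main.v *)
Require Import Defs.
From mathcomp Require Import all_boot all_order all_algebra.
From mathcomp Require Import boolp classical_sets reals ereal sequences exp.
From mathcomp Require Import fintype finset zify ring lra.
Import Order.TTheory GRing.Theory Num.Theory.
Set Implicit Arguments.
Unset Strict Implicit.
Unset Printing Implicit Defensive.
Local Open Scope ring_scope.

(** Why the algorithm is optimal.

    The cost of contracting [(A, B)] is the exponential of the weight of the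
    edges leaving [A] or [B] ([contraction_cost_crosses]); it splits into a
    data part, carried by the edges outside the embedding, and an embedding
    part ([combined_cost]).  Write [M] for the sketch size of an embedding and
    [mu = ln M].  In a sketching linearization every vertex, data vertices
    included, is the tail of edges of total weight at least [mu]
    ([mu_le_out]), an edge has only one tail ([out_edge_tail]), and the edges
    with tail the last vertex of a set all leave this set
    ([out_edge_crosses]).  Hence the out-edges of the last vertices of two
    disjoint sets are disjoint families, and every contraction has an embedding
    part of at least [2 mu] ([costL_ge2]).

    Consider the contraction [(X, Y)] of the constrained tree lying over a
    contraction [(U, W)] of the data tree.  Let the last vertex [y] of
    [X :|: Y] be in [Y], let [x] be the last vertex of [X], and let [t] be the
    weight of the out-edges of [x] that end in [Y].  The contraction that
    created [Y] has an embedding part of at least [2 mu + t], since the edges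
    from [x] into [Y] leave one of its two operands ([costL_created]).  The
    contraction that consumes [X :|: Y] with some [W'] has an embedding part of
    at least [3 mu - t]: it pays for the out-edges of [y], for those of the last
    vertex of [W'], and for those of [x] that avoid [Y] ([costL_consumed]).  If
    [Y] is a leaf then [t = 0] ([flow_leaf]), and if [X :|: Y] is the root then
    [t >= mu] ([flow_root]); in both cases the missing bound follows from that
    of [(X, Y)] itself.  With [theta = exp t] these bounds are

      [abcd M^2],   [min(a, c) b d theta M^2],   [a c d M^3 / theta],

    which are the three terms of the cost of the small network with [theta] in
    place of [alpha]; the [alpha] of the algorithm is the best choice, up to a
    multiple of the first term ([clamped_minimizer]).  Likewise the contraction
    consuming the leaf [v_j] pays for the multiplication by the matrix attached
    to [e_j] ([matrix_lower_bound]).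

    Finally, the vertex sets occurring in a contraction tree are pairwise
    distinct, so each contraction of the constrained tree is charged a bounded
    number of times ([sum_charge], [sum_matrix_charge]).  Replacing [m] by the
    possibly smaller [M >= m / k] costs at most the factor [max(1, k)^3]. *)

(** * Cuts as sums over crossing edges *)

Section Crossing.
Variables (R : realType) (V E : finType) (G : network R V E).

Definition crosses (A : {set V}) (e : E) : bool :=
  (ends G e :&: A != set0) && (dangling G e || ~~ (ends G e \subset A)).

Lemma crosses_setU (A B : {set V}) (e : E) :
  crosses (A :|: B) e -> crosses A e || crosses B e.
Proof.
rewrite /crosses setIUr => /andP[+ leave].
rewrite -!subset0 subUset negb_and => /orP[] meets;
  apply/orP; [left | right]; rewrite meets /=;
  case/orP: leave => [-> // | nsub]; apply/orP; right;
  apply: contra nsub => sub; apply: (subset_trans sub);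
  [exact: subsetUl | exact: subsetUr].
Qed.

Hypothesis ends_neq0 : forall e, (0 < #|ends G e|)%N.

Lemma cut_weight_crosses (H : {set E}) (A : {set V}) :
  cut_weight G H A = \sum_(e in H | crosses A e) wt G e.
Proof.
rewrite /cut_weight /cut_between /cut_dangling.
rewrite [X in _ = X](bigID (fun e => ends G e \subset A)) /= addrC.
congr (_ + _); apply: eq_bigl => e; rewrite /crosses -!andbA; congr andb.
- by rewrite -setDE setD_eq0; case: (ends G e \subset A);
    rewrite ?andbF ?orbT ?andbT.
- have [sub|nsub] := boolP (ends G e \subset A); rewrite ?andbF // !andbT orbF.
  have -> : ends G e :&: A != set0 by rewrite (setIidPl sub) -card_gt0.
  by [].
Qed.

(** An edge meeting both [A] and [B] leaves both, hence is counted once in each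
    cut, and the subtraction of [cut_between] leaves it counted once. *)
Lemma contraction_cost_crosses (H : {set E}) (A B : {set V}) :
  [disjoint A & B] ->
  contraction_cost G H A B =
    \sum_(e in H | crosses A e || crosses B e) wt G e.
Proof.
move=> dAB; rewrite /contraction_cost !cut_weight_crosses /cut_between.
rewrite !big_mkcondr /= -big_split -sumrB /=; apply: eq_bigr => e _.
have key (A' B' : {set V}) : [disjoint A' & B'] -> ends G e :&: A' != set0 ->
    ends G e :&: B' != set0 -> crosses A' e.
  move=> dAB' mA /set0Pn[x /setIP[xe xB]]; rewrite /crosses mA /=.
  apply/orP; right; apply/subsetPn; exists x => //.
  by rewrite (disjointFl dAB' xB).
have [mA|nA] := boolP (ends G e :&: A != set0); last first.
  by rewrite /crosses (negbTE nA) /= subr0 add0r.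
have [mB|nB] := boolP (ends G e :&: B != set0); last first.
  by rewrite /crosses (negbTE nB) andbF /= orbF addr0 subr0.
rewrite (key _ _ dAB mA mB) (key B A) //=; last by rewrite disjoint_sym.
by rewrite addrK.
Qed.

Lemma contraction_costC (H : {set E}) (A B : {set V}) :
  contraction_cost G H A B = contraction_cost G H B A.
Proof.
rewrite /contraction_cost [cut_weight G H A + _]addrC; congr (_ - _).
by rewrite /cut_between; apply: eq_bigl => e; rewrite [X in _ && X]andbC.
Qed.

Hypothesis wt_ge0 : forall e, 0 <= wt G e.

Lemma ler_sum_subset (P Q : pred E) :
  (forall e, P e -> Q e) -> \sum_(e | P e) wt G e <= \sum_(e | Q e) wt G e.
Proof.
move=> PQ; rewrite [leRHS](bigID P) /=.
rewrite [X in _ <= X + _](_ : _ = \sum_(e | P e) wt G e).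
  by rewrite lerDl sumr_ge0.
by apply: eq_bigl => e; case Pe: (P e); rewrite ?andbT ?andbF ?PQ.
Qed.

Lemma cut_weight_le_cost (H : {set E}) (A B : {set V}) :
  [disjoint A & B] -> cut_weight G H A <= contraction_cost G H A B.
Proof.
move=> dAB; rewrite cut_weight_crosses contraction_cost_crosses //.
by apply: ler_sum_subset => e /andP[-> ->].
Qed.

Lemma cut_weight_setU_le_cost (H : {set E}) (A B : {set V}) :
  [disjoint A & B] -> cut_weight G H (A :|: B) <= contraction_cost G H A B.
Proof.
move=> dAB; rewrite cut_weight_crosses contraction_cost_crosses //.
by apply: ler_sum_subset => e /andP[-> /crosses_setU].
Qed.

End Crossing.

(** * Vertex sets of a contraction tree *)

Section TreeNodes.
Variable V : finType.
Implicit Types (T : ctree V) (S : {set V}) (c : {set V} * {set V}).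

(** In contrast with [contractions], this lists the leaves and the root too, so
    that counting operands and counting results of contractions both reduce to
    counting in one duplicate-free list. *)
Fixpoint nodes T : seq {set V} :=
  if T is Node T1 T2 then leaves T :: nodes T1 ++ nodes T2 else [:: leaves T].

Definition ctree_disjoint T : bool :=
  all (fun c : {set V} * {set V} => [disjoint c.1 & c.2]) (contractions T).

Lemma leaves_neq0 T : leaves T != set0.
Proof.
elim: T => [v|T1 IH1 T2 _] /=; first by apply/set0Pn; exists v; rewrite set11.
by rewrite -subset0 subUset negb_and subset0 IH1.
Qed.

Lemma node_sub T S : S \in nodes T -> S \subset leaves T.
Proof.
elim: T => [v|T1 IH1 T2 IH2] /=; first by rewrite inE => /eqP ->.
rewrite inE mem_cat => /or3P[/eqP -> // | /IH1 | /IH2] sub;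
 apply: (subset_trans sub); [exact: subsetUl | exact: subsetUr].
Qed.

Lemma node_neq0 T S : S \in nodes T -> S != set0.
Proof.
elim: T => [v|T1 IH1 T2 IH2] /=.
  by rewrite inE => /eqP ->; exact: (leaves_neq0 (Leaf v)).
rewrite inE mem_cat => /or3P[/eqP -> | /IH1 | /IH2] //.
exact: (leaves_neq0 (Node T1 T2)).
Qed.

Lemma count_nodes (P : pred {set V}) T :
  count P (nodes T) = (P (leaves T) +
    (count (fun c => P c.1) (contractions T) +
     count (fun c => P c.2) (contractions T)))%N.
Proof.
elim: T => [v|T1 IH1 T2 IH2] /=; first by rewrite addn0.
rewrite !count_cat /= IH1 IH2 !addn0; congr addn.
set p1 := nat_of_bool _; set p2 := nat_of_bool _; lia.
Qed.

Lemma count_unions (P : pred {set V}) T :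
  (count (fun c => P (c.1 :|: c.2)) (contractions T) <= count P (nodes T))%N.
Proof.
elim: T => [v|T1 IH1 T2 IH2] //=.
by rewrite !count_cat /= addn0 addnA addnC leq_add2l leq_add.
Qed.

Lemma nodes_uniq T : ctree_disjoint T -> uniq (nodes T).
Proof.
elim: T => [v|T1 IH1 T2 IH2] //=.
rewrite /ctree_disjoint /= !all_cat /= andbT => /and3P[/IH1 u1 /IH2 u2 dis].
rewrite cat_uniq u1 u2 mem_cat negb_or !andbT -andbA.
have strict S S' : S' != set0 -> [disjoint S & S'] ->
    S :|: S' \subset S -> False.
  move=> /set0Pn[x xS'] dSS' /subsetP/(_ x); rewrite inE xS' orbT => /(_ isT).
  by rewrite (disjointFl dSS' xS').
apply/and3P; split.
- by apply/negP => /node_sub; exact: strict (leaves_neq0 _) dis.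
- apply/negP => /node_sub; rewrite setUC.
  by apply: strict (leaves_neq0 _) _; rewrite disjoint_sym.
- apply/hasPn => S S2; apply/negP => /= S1.
  have /set0Pn[x xS] := node_neq0 S1.
  have := disjointFr dis (subsetP (node_sub S1) _ xS).
  by rewrite (subsetP (node_sub S2) _ xS).
Qed.

Lemma leaf_node T x : x \in leaves T -> [set x]%SET \in nodes T.
Proof.
elim: T => [v|T1 IH1 T2 IH2] /=; first by rewrite !inE => /eqP ->.
by rewrite !inE mem_cat => /orP[/IH1|/IH2] ->; rewrite ?orbT.
Qed.

Lemma contraction_nodes T c : c \in contractions T ->
  [/\ c.1 \in nodes T, c.2 \in nodes T & c.1 :|: c.2 \in nodes T].
Proof.
have top T' : leaves T' \in nodes T' by case: T' => *; exact: mem_head.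
elim: T => [v|T1 IH1 T2 IH2] //=.
rewrite !mem_cat !inE => /or3P[/IH1 [a b d]|/IH2 [a b d]|/eqP ->] /=;
  rewrite ?mem_cat ?a ?b ?d ?top ?eqxx ?orbT; by split.
Qed.

Lemma node_created T S : S \in nodes T ->
  (exists x, S = [set x]%SET) \/
  (exists2 c, c \in contractions T & c.1 :|: c.2 = S).
Proof.
elim: T => [v|T1 IH1 T2 IH2] /=; first by rewrite inE => /eqP ->; left; exists v.
rewrite inE mem_cat => /or3P[/eqP ->|/IH1 [|[c cT cS]]|/IH2 [|[c cT cS]]];
  try by left.
- by right; exists (leaves T1, leaves T2) => //; rewrite !mem_cat inE eqxx !orbT.
- by right; exists c => //; rewrite mem_cat cT.
- by right; exists c => //; rewrite !mem_cat cT orbT.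
Qed.

Lemma node_consumed T S : S \in nodes T ->
  S = leaves T \/
  (exists2 c, c \in contractions T & (c.1 == S) || (c.2 == S)).
Proof.
move=> ST; have : (0 < count (pred1 S) (nodes T))%N by rewrite -has_count has_pred1.
rewrite count_nodes /=; case: (eqVneq (leaves T) S) => [-> _|_]; first by left.
rewrite add0n addn_gt0 -!has_count => /orP[] /hasP[c cT cS]; right; exists c => //.
  by rewrite cS.
by rewrite cS orbT.
Qed.

End TreeNodes.

(** * Lower bounds from a sketching linearization *)

Lemma sum_disjoint_preds (R : realType) (E : finType) (P Q : pred E)
    (w : E -> R) : (forall e, P e -> Q e -> false) ->
  \sum_(e | P e || Q e) w e = \sum_(e | P e) w e + \sum_(e | Q e) w e.
Proof.
move=> PQ; rewrite (bigID P) /=; congr (_ + _); apply: eq_bigl => e.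
  by case: (P e); rewrite ?orbT ?andbF.
by case Pe: (P e); case Qe: (Q e) => //; have := PQ e Pe Qe.
Qed.

Lemma max_rank_vertex (V : finType) (rk : V -> nat) (A : {set V}) :
  A != set0 -> exists2 v, v \in A & forall u, u \in A -> (rk u <= rk v)%N.
Proof.
case/set0Pn => x xA; case: (arg_maxnP rk xA) => v vA vmax.
by exists v => // u uA; exact: vmax.
Qed.

Section Linearization.
Variables (R : realType) (VD ED VE F : finType).
Variables (D : network R VD ED) (Ebar : {set ED}) (Em : embedding R ED VE F).
Variable rk : (VD + VE)%type -> nat.
Hypothesis sk : sketchable D Ebar.
Hypothesis cover : forall v : VD, exists2 e, e \in Ebar & v \in ends D e.
Hypothesis wfE : wf_embedding Em.
Hypothesis big_dims : {in Ebar, forall e, sketch_size Em < expR (wt D e)}.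
Hypothesis rk_order : sketching_order rk.
Hypothesis rk_out : forall v : VE,
  ln (sketch_size Em) <= outgoing D Ebar Em rk (inr v).

Let G := combined D Ebar Em.
Let EE := @embedding_edges ED F Ebar.
Let mu := ln (sketch_size Em).
Let data (A : {set VD + VE}) : {set VD} := inl @^-1: A.

(** [outgoing] is the weight of the edges selected by this predicate. *)
Definition out_edge (v : VD + VE) (e : ED + F) : bool :=
  (e \in EE) && ((v \in ends G e) &&
    (dangling G e || [exists u in ends G e, (rk v < rk u)%N])).

Lemma combined_ends_gt0 e : (0 < #|ends G e|)%N.
Proof.
case: e => [e|f] /=; last first.
  rewrite card_imset; last by move=> x y [].
  by have [_ ->] := wfE f; case: ifP.
have [wfD _ _] := sk; have [_ e0 _] := wfD e.
rewrite card_gt0 -subset0 subUset negb_and subset0 -card_gt0.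
by rewrite card_imset ?e0 // => x y [].
Qed.

Lemma combined_wt_ge0 e : 0 <= wt G e.
Proof.
case: e => [e|f] /=; last by have [] := wfE f.
by have [wfD _ _] := sk; have [] := wfD e.
Qed.

Lemma card_ends_embedding_edge e : e \in EE ->
  #|ends G e| = (if dangling G e then 1 else 2)%N.
Proof.
case: e => [e|f] /=; rewrite inE => He; last first.
  by rewrite card_imset; [have [_ ->] := wfE f | move=> x y []].
have [_ one _] := sk; have [_ ce] := one e He.
rewrite He andbF setUC cardsU1 card_imset ?ce; last by move=> x y [].
by rewrite (_ : inr _ \notin _) //; apply/negP => /imsetP[].
Qed.

(** An embedding edge has two ends, or one end and a dangling one; it is directed
    to the end of higher rank or outward, so it has a single tail. *)
Lemma out_edge_tail u v e : out_edge u e -> out_edge v e -> u = v.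
Proof.
case/and3P=> eE ue upu /and3P[_ ve upv].
have := card_ends_embedding_edge eE; case: ifP upu upv => [_ _ _ | _].
  by move/eqP/cards1P => [x ex]; move: ue ve; rewrite ex !inE => /eqP -> /eqP ->.
case/existsP=> u' /andP[u'e uu'] /existsP[v' /andP[v'e vv']] c2.
apply/eqP/negPn/negP => neq.
have eq2 : [set u; v]%SET = ends G e.
  apply/eqP; rewrite eqEcard cards2 neq c2 andbT; apply/subsetP => x.
  by rewrite !inE => /orP[] /eqP ->.
move: u'e v'e uu' vv'; rewrite -eq2 !inE.
by case/orP=> /eqP ->; case/orP=> /eqP ->; lia.
Qed.

Lemma out_edge_crosses (A : {set VD + VE}) v e :
  v \in A -> (forall u, u \in A -> (rk u <= rk v)%N) ->
  out_edge v e -> crosses G A e.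
Proof.
move=> vA vmax /and3P[_ ve up]; apply/andP; split.
  by apply/set0Pn; exists v; rewrite inE ve.
case/orP: up => [-> // | /existsP[u /andP[ue vu]]].
apply/orP; right; apply/subsetPn; exists u => //.
by apply/negP => /vmax; lia.
Qed.

Lemma data_edge_out v e : e \in Ebar -> v \in ends D e -> out_edge (inl v) (inl e).
Proof.
move=> eE ve; rewrite /out_edge inE eE /= !inE imset_f //=.
apply/orP; right; apply/existsP; exists (inr (sketcher Em e)).
by rewrite /= eE !inE eqxx orbT /=; have [_ ->] := rk_order.
Qed.

(** For an embedding vertex this is the effective sketch dimension of the class;
    for a data vertex it is the assumption [s_j > M] on the edge to be sketched
    at this vertex, whose other end has higher rank. *)
Lemma mu_le_out v : mu <= \sum_(e | out_edge v e) wt G e.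
Proof.
case: v => v; last exact: rk_out.
have [e eE ve] := cover v.
rewrite (bigD1 (inl e)) /=; last exact: data_edge_out.
apply: ler_wpDr; first by apply: sumr_ge0 => x _; exact: combined_wt_ge0.
rewrite -(expRK (wt D e)) ler_ln ?posrE ?expR_gt0 //.
exact: ltW (big_dims eE).
Qed.

(** The embedding part of the exponent of the cost of [(A, B)]. *)
Definition costL (A B : {set VD + VE}) : R :=
  \sum_(e | (e \in EE) && (crosses G A e || crosses G B e)) wt G e.

Lemma costL_ge (P : pred (ED + F)) (A B : {set VD + VE}) :
  (forall e, P e -> (e \in EE) && (crosses G A e || crosses G B e)) ->
  \sum_(e | P e) wt G e <= costL A B.
Proof. by move=> sub; apply: ler_sum_subset => // e; exact: combined_wt_ge0. Qed.

Lemma out_edge_inE v e : out_edge v e -> e \in EE. Proof. by case/andP. Qed.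

(** The last vertices of [A] and [B] have disjoint families of out-edges, which
    all leave [A], resp. [B]. *)
Lemma costL_ge2 (A B : {set VD + VE}) :
  A != set0 -> B != set0 -> [disjoint A & B] -> mu + mu <= costL A B.
Proof.
move=> /(max_rank_vertex rk)[a aA amax] /(max_rank_vertex rk)[b bB bmax] dAB.
have neq : a <> b by move=> ab; have := disjointFr dAB aA; rewrite ab bB.
apply: le_trans (lerD (mu_le_out a) (mu_le_out b)) _.
rewrite -sum_disjoint_preds; last by move=> e oa /(out_edge_tail oa).
apply: costL_ge => e /orP[] oe; rewrite (out_edge_inE oe).
  by rewrite (out_edge_crosses aA amax oe).
by rewrite (out_edge_crosses bB bmax oe) orbT.
Qed.

Definition meets (Y : {set VD + VE}) (e : ED + F) : bool :=
  ends G e :&: Y != set0.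

(** The parameter [t] of the trade-off, for [x] the last vertex of [X]. *)
Definition flow (x : VD + VE) (Y : {set VD + VE}) : R :=
  \sum_(e | out_edge x e && meets Y e) wt G e.

Lemma mu_sub_flow_le x Y :
  mu - flow x Y <= \sum_(e | out_edge x e && ~~ meets Y e) wt G e.
Proof. by rewrite lerBlDl -bigID; exact: mu_le_out. Qed.

(** In addition to the bound [2 mu], an edge from [x] into [A :|: B] leaves the
    operand that it meets, because its tail [x] is in neither; it cannot be an
    out-edge of a vertex of [A] or [B]. *)
Lemma costL_created (A B : {set VD + VE}) x :
  A != set0 -> B != set0 -> [disjoint A & B] -> x \notin A :|: B ->
  mu + mu + flow x (A :|: B) <= costL A B.
Proof.
move=> /(max_rank_vertex rk)[a aA amax] /(max_rank_vertex rk)[b bB bmax] dAB.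
rewrite inE negb_or => /andP[xA xB].
have neq : a <> b by move=> ab; have := disjointFr dAB aA; rewrite ab bB.
apply: le_trans (lerD (lerD (mu_le_out a) (mu_le_out b)) (lexx _)) _.
rewrite -!sum_disjoint_preds; first last.
- by move=> e oa /(out_edge_tail oa).
- move=> e /orP[] oe /andP[/(out_edge_tail oe) ox _].
    by move: aA xA; rewrite ox => ->.
  by move: bB xB; rewrite ox => ->.
apply: costL_ge => e /orP[/orP[]|] oe.
- by rewrite (out_edge_inE oe) (out_edge_crosses aA amax oe).
- by rewrite (out_edge_inE oe) (out_edge_crosses bB bmax oe) orbT.
case/andP: oe => oe; rewrite (out_edge_inE oe) /meets setIUr.
have xe : x \in ends G e by case/and3P: oe.
rewrite -subset0 subUset negb_and !subset0 => /orP[] m; apply/orP;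
  [left | right]; rewrite /crosses m; apply/orP; right;
  by apply/subsetPn; exists x.
Qed.

Section MaxOnTheRight.
Variables (X Y : {set VD + VE}) (x y : VD + VE).
Hypothesis dXY : [disjoint X & Y].
Hypothesis xX : x \in X.
Hypothesis xmax : forall u, u \in X -> (rk u <= rk x)%N.
Hypothesis yY : y \in Y.
Hypothesis ymax : forall u, u \in X :|: Y -> (rk u <= rk y)%N.

Lemma out_edge_leaves e :
  out_edge x e -> ~~ meets Y e -> crosses G (X :|: Y) e.
Proof.
move=> /and3P[_ xe up] /negPn/eqP nY; apply/andP; split.
  by apply/set0Pn; exists x; rewrite !inE xe xX.
case/orP: up => [-> // | /existsP[u /andP[ue xu]]].
apply/orP; right; apply/subsetPn; exists u => //.
rewrite inE negb_or; apply/andP; split; first by apply/negP => /xmax; lia.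
by apply/negP => uY; have := in_set0 u; rewrite -nY inE ue uY.
Qed.

Lemma max_vertices_neq : x <> y.
Proof. by move=> xy; have := disjointFr dXY xX; rewrite xy yY. Qed.

(** The out-edges of [x] that avoid [Y] leave [X :|: Y], as do those of [y]; the
    out-edges of the last vertex of [W] leave [W].  The three tails are distinct, so
    these three families are disjoint. *)
Lemma costL_consumed (W : {set VD + VE}) :
  W != set0 -> [disjoint X :|: Y & W] ->
  mu + mu + (mu - flow x Y) <= costL (X :|: Y) W.
Proof.
move=> /(max_rank_vertex rk)[w wW wmax] dW.
have yZ : y \in X :|: Y by rewrite inE yY orbT.
have xZ : x \in X :|: Y by rewrite inE xX.
have wy : w <> y by move=> wy; have := disjointFr dW yZ; rewrite -wy wW.
have wx : w <> x by move=> wx; have := disjointFr dW xZ; rewrite -wx wW.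
apply: le_trans
  (lerD (lerD (mu_le_out w) (mu_le_out y)) (mu_sub_flow_le x Y)) _.
rewrite -!sum_disjoint_preds; first last.
- by move=> e oa /(out_edge_tail oa).
- move=> e /orP[] oe /andP[/(out_edge_tail oe) ox _] //.
  by have := max_vertices_neq; rewrite ox.
apply: costL_ge => e /orP[/orP[]|/andP[]] oe.
- by rewrite (out_edge_inE oe) (out_edge_crosses wW wmax oe) orbT.
- by rewrite (out_edge_inE oe) (out_edge_crosses yZ ymax oe).
- by move/(out_edge_leaves oe) => c; rewrite (out_edge_inE oe) c.
Qed.

(** At the root, an edge that leaves [X :|: Y] is dangling.  The dangling edges
    have total weight [mu], already reached by the out-edges of [y], so all the
    output of [x] must go into [Y]. *)
Lemma flow_root : X :|: Y = [set: VD + VE]%SET -> mu <= flow x Y.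
Proof.
move=> XY.
have all_dangling e : crosses G (X :|: Y) e -> dangling G e.
  by rewrite XY => /andP[_ /orP[// | /negP]]; case; exact: subsetT.
have total : \sum_(e | (e \in EE) && dangling G e) wt G e = mu.
  rewrite /mu expRK big_sumType /= big1 ?add0r; last first.
    by move=> e; rewrite inE /= => /and3P[-> _].
  by apply: eq_bigl => f; rewrite !inE.
have yZ : y \in X :|: Y by rewrite inE yY orbT.
suff : mu - flow x Y + mu <= mu by lra.
apply: le_trans (lerD (mu_sub_flow_le x Y) (mu_le_out y)) _.
rewrite -sum_disjoint_preds; last first.
  by move=> e /andP[oe _] /(out_edge_tail oe) xy; have := max_vertices_neq.
rewrite -[leRHS]total; apply: ler_sum_subset => [|e]; first exact: combined_wt_ge0.
case/orP=> [/andP[oe nm]|oe]; rewrite (out_edge_inE oe) all_dangling //.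
  exact: out_edge_leaves.
exact: out_edge_crosses oe.
Qed.

(** If the last vertex is a data vertex, then [X] has only data vertices, as the
    data precede the embedding, and no embedding edge joins two of these. *)
Lemma flow_leaf v : Y = [set inl v]%SET -> flow x Y = 0.
Proof.
move=> Yv; have yv : y = inl v by move: yY; rewrite Yv inE => /eqP.
case: x xX (max_vertices_neq) => [x'|x'] x'X neq; last first.
  have := ymax (_ : inr x' \in X :|: Y); rewrite inE x'X => /(_ isT).
  by rewrite yv; have [_ /(_ v x')] := rk_order; lia.
rewrite /flow big1 // => e /andP[/and3P[eE xe _]].
rewrite /meets Yv => /set0Pn[u]; rewrite !inE => /andP[ve /eqP uv]; rewrite {u}uv in ve.
case: e eE xe ve => [e|f] /=; last by move=> _ /imsetP[].
rewrite inE => eE; rewrite eE !inE !orbF !mem_imset; try by move=> ? ? [].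
have [_ one _] := sk; have [_ /eqP/cards1P[z ->]] := one e eE.
by rewrite !inE => /eqP xz /eqP vz; case: neq; rewrite yv xz vz.
Qed.

End MaxOnTheRight.

Lemma disjoint_data (A B : {set VD + VE}) :
  [disjoint A & B] -> [disjoint data A & data B].
Proof. by rewrite -!setI_eq0 -preimsetI => /eqP ->; rewrite preimset0. Qed.

Lemma crosses_data (A : {set VD + VE}) e :
  e \notin Ebar -> crosses G A (inl e) = crosses D (data A) e.
Proof.
move=> /negbTE eE; rewrite /crosses /= eE andbT setU0; congr (_ && (_ || ~~ _)).
  apply/set0Pn/set0Pn => [[_ /setIP[/imsetP[v ve ->] vA]]|[v /setIP[ve vA]]].
    by exists v; rewrite !inE ve.
  by exists (inl v); rewrite inE imset_f //; move: vA; rewrite inE.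
by rewrite sub_imset_pre.
Qed.

Lemma data_ends_gt0 e : (0 < #|ends D e|)%N.
Proof. by have [wfD _ _] := sk; have [] := wfD e. Qed.

Lemma data_wt_ge0 e : 0 <= wt D e.
Proof. by have [wfD _ _] := sk; have [] := wfD e. Qed.

(** The embedding meets the data only through the edges to be sketched, so the
    data part depends on the traces of [A] and [B] on the data only. *)
Lemma combined_cost (A B : {set VD + VE}) : [disjoint A & B] ->
  contraction_cost G [set: ED + F]%SET A B =
    contraction_cost D (~: Ebar) (data A) (data B) + costL A B.
Proof.
move=> dAB; rewrite !contraction_cost_crosses ?disjoint_data //; first last.
- exact: combined_ends_gt0.
- exact: data_ends_gt0.
rewrite (bigID (mem EE)) /= addrC; congr (_ + _); last first.
  by apply: eq_bigl => e; rewrite inE andbC.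
rewrite big_sumType /= [X in _ + X]big1 ?addr0; last first.
  by move=> f; rewrite !inE andbF.
apply: eq_bigl => e; rewrite !inE andbC; case eE: (e \in Ebar) => //=.
by rewrite !crosses_data ?eE.
Qed.

Let cost (c : {set VD + VE} * {set VD + VE}) : R :=
  contraction_cost G [set: ED + F]%SET c.1 c.2.
Let cutR := cutR D Ebar.

Variable TB : ctree (VD + VE)%type.
Hypothesis TB_tree : is_contraction_tree TB.

Lemma contraction_sets c : c \in contractions TB ->
  [/\ c.1 != set0, c.2 != set0 & [disjoint c.1 & c.2]].
Proof.
move=> cT; have [n1 n2 _] := contraction_nodes cT.
split; [exact: node_neq0 n1 | exact: node_neq0 n2 |].
by have [/allP/(_ _ cT)] := TB_tree.
Qed.

Lemma parent_contraction (Z : {set VD + VE}) :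
  Z \in nodes TB -> Z != [set: VD + VE]%SET ->
  exists c W, [/\ c \in contractions TB, (c.1 == Z) || (c.2 == Z),
    W != set0, [disjoint Z & W] &
    cutR (data Z) + costL Z W <= cost c].
Proof.
move=> ZT Znt; have [Zl|[c cT cZ]] := node_consumed ZT.
  by move: Znt; have [_ <-] := TB_tree; rewrite Zl eqxx.
have [n1 n2 d] := contraction_sets cT.
have cutL (A B : {set VD + VE}) : [disjoint A & B] ->
    cutR (data A) <= contraction_cost D (~: Ebar) (data A) (data B).
  move=> dAB; apply: cut_weight_le_cost; rewrite ?disjoint_data //.
    exact: data_ends_gt0.
  exact: data_wt_ge0.
case/orP: (cZ) => /eqP eZ; rewrite -{}eZ in cZ *.
  exists c, c.2; split => //.
  by rewrite /cost combined_cost // lerD2r cutL.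
rewrite disjoint_sym in d; exists c, c.1; split => //.
by rewrite /cost contraction_costC combined_cost // lerD2r cutL.
Qed.

(** The leaf [v] of [e] is consumed by a contraction with some [W], which pays for
    [e] and for the out-edges of the last vertex of [W]; [e] is not among
    the latter, since its tail is [v]. *)
Lemma matrix_lower_bound e : e \in Ebar ->
  exists2 c, c \in contractions TB &
    ((c.1 == inl @: ends D e) || (c.2 == inl @: ends D e)) /\
    cutR (ends D e) + (wt D e + mu) <= cost c.
Proof.
move=> eE; have [_ one _] := sk; have [_ /eqP/cards1P[v ev]] := one e eE.
have vT : [set inl v]%SET \in nodes TB.
  by apply: leaf_node; have [_ ->] := TB_tree; rewrite inE.
have vnt : [set inl v]%SET != [set: VD + VE]%SET.
  apply/negP => /eqP/setP/(_ (inr (sketcher Em e))).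
  by rewrite !inE.
have [c [W [cT cv W0 dW le]]] := parent_contraction vT vnt.
exists c => //; rewrite ev imset_set1; split => //.
apply: le_trans le; apply: lerD.
  rewrite (_ : data _ = [set v]%SET) //; apply/setP => x; rewrite !inE.
  by apply/eqP/eqP => [[]|->].
have [w wW wmax] := max_rank_vertex rk W0.
have wv : w <> inl v.
  by move=> wv; have := disjointFr dW (set11 (inl v)); rewrite -wv wW.
have oe : out_edge (inl v) (inl e) by apply: data_edge_out; rewrite ?ev ?set11.
have -> : wt D e = \sum_(x | x == inl e) wt G x by rewrite big_pred1_eq.
apply: le_trans (lerD (lexx _) (mu_le_out w)) _.
rewrite -sum_disjoint_preds; last first.
  by move=> x /eqP -> /(out_edge_tail oe) vw; case: wv.
apply: costL_ge => x /orP[/eqP -> {x}|ow].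
  rewrite (out_edge_inE oe) (out_edge_crosses _ _ oe) ?set11 // => u.
  by rewrite inE => /eqP ->.
by rewrite (out_edge_inE ow) (out_edge_crosses wW wmax ow) orbT.
Qed.

(** [t] is the flow from the last vertex of [X] into [Y].  The two alternatives
    [t = 0] and [mu <= t] are those where [Y] has not been created by a
    contraction, resp. where [X :|: Y] is not an operand of any: there the
    bound [2 mu] on [(X, Y)] is enough. *)
Lemma tradeoff_oriented (X Y : {set VD + VE}) y :
  X \in nodes TB -> Y \in nodes TB -> X :|: Y \in nodes TB ->
  [disjoint X & Y] -> data Y != set0 ->
  y \in Y -> (forall u, u \in X :|: Y -> (rk u <= rk y)%N) ->
  exists t : R,
    (t = 0 \/ exists2 c, c \in contractions TB &
       c.1 :|: c.2 = Y /\ cutR (data Y) + (mu + mu + t) <= cost c) /\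
    (mu <= t \/ exists2 c, c \in contractions TB &
       ((c.1 == X :|: Y) || (c.2 == X :|: Y)) /\
       cutR (data (X :|: Y)) + (mu + mu + (mu - t)) <= cost c).
Proof.
move=> XT YT ZT dXY dY yY ymax.
have [x xX xmax] := max_rank_vertex rk (node_neq0 XT).
exists (flow x Y); split.
  have [[v Yv]|[c cT cY]] := node_created YT.
    left; case: v Yv => v Yv; first exact: (flow_leaf dXY xX yY ymax Yv).
    by case/set0Pn: dY => u; rewrite !inE Yv inE.
  have [n1 n2 d] := contraction_sets cT.
  right; exists c => //; split => //; rewrite /cost combined_cost //.
  apply: lerD.
    rewrite -cY /data preimsetU; apply: cut_weight_setU_le_cost.
    - exact: data_ends_gt0.
    - exact: data_wt_ge0.
    - exact: disjoint_data.
  by rewrite -cY; apply: costL_created => //; rewrite cY (disjointFr dXY xX).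
have [XYt|XYt] := eqVneq (X :|: Y) [set: VD + VE]%SET.
  by left; exact: (flow_root dXY xX xmax yY ymax XYt).
right; have [c [W [cT cZ W0 dW le]]] := parent_contraction ZT XYt.
exists c => //; split => //; apply: le_trans le; rewrite lerD2l.
exact: (costL_consumed dXY xX xmax yY ymax W0 dW).
Qed.

(** [Y] is the operand containing the last vertex of the union. *)
Lemma tradeoff c : c \in contractions TB ->
  data c.1 != set0 -> data c.2 != set0 ->
  exists (t : R) (Y : {set VD + VE}), [/\ Y = c.1 \/ Y = c.2,
    t = 0 \/ exists2 c', c' \in contractions TB &
       c'.1 :|: c'.2 = Y /\ cutR (data Y) + (mu + mu + t) <= cost c' &
    mu <= t \/ exists2 c', c' \in contractions TB &
       ((c'.1 == c.1 :|: c.2) || (c'.2 == c.1 :|: c.2)) /\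
       cutR (data (c.1 :|: c.2)) + (mu + mu + (mu - t)) <= cost c'].
Proof.
move=> cT d1 d2; have [_ _ d] := contraction_sets cT.
have [n1 n2 n12] := contraction_nodes cT.
have [y yZ ymax] := max_rank_vertex rk (node_neq0 n12).
move: (yZ); rewrite inE => /orP[y1|y2].
  rewrite setUC in n12 ymax *; rewrite disjoint_sym in d.
  have [t [H1 H2]] := tradeoff_oriented n2 n1 n12 d d1 y1 ymax.
  by exists t, c.1; split => //; left.
have [t [H1 H2]] := tradeoff_oriented n1 n2 n12 d d2 y2 ymax.
by exists t, c.2; split => //; right.
Qed.

Lemma cost_lower_bound c : c \in contractions TB ->
  contraction_cost D (~: Ebar) (data c.1) (data c.2) + (mu + mu) <= cost c.
Proof.
move=> cT; have [n1 n2 d] := contraction_sets cT.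
by rewrite /cost combined_cost // lerD2l costL_ge2.
Qed.

End Linearization.

(** * The cost of the small networks *)

Section ConcreteNetworks.
Variables (R : realType) (V : finType).

Lemma meets_set1 (x : V) (A : {set V}) : ([set x]%SET :&: A != set0) = (x \in A).
Proof. by rewrite setI_eq0 disjoints1 negbK. Qed.

Lemma meets_set2 (x y : V) (A : {set V}) :
  ([set x; y]%SET :&: A != set0) = (x \in A) || (y \in A).
Proof. by rewrite setIUl setU_eq0 negb_and !meets_set1. Qed.

Lemma sub_set2 (x y : V) (A : {set V}) :
  ([set x; y]%SET \subset A) = (x \in A) && (y \in A).
Proof. by rewrite subUset !sub1set. Qed.

Definition listed_crosses (A : {set V}) (x : {set V} * bool * R) : bool :=
  (x.1.1 :&: A != set0) && (x.1.2 || ~~ (x.1.1 \subset A)).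

(** Stated with [foldr] so that the sum over a concrete list unfolds by
    conversion. *)
Lemma network_of_cost (s : seq ({set V} * bool * R)) (A B : {set V}) :
  all (fun x => x.1.1 != set0) s -> [disjoint A & B] ->
  contraction_cost (network_of s) [set: _]%SET A B =
    foldr (fun x cost =>
      (if listed_crosses A x || listed_crosses B x then x.2 else 0) + cost) 0 s.
Proof.
move=> /allP nz dAB; rewrite contraction_cost_crosses //; last first.
  by move=> i; rewrite card_gt0; apply: nz; exact: mem_tnth.
rewrite [RHS](_ : _ = \sum_(x <- s | listed_crosses A x || listed_crosses B x) x.2).
  by rewrite [RHS]big_tnth; apply: eq_bigl => i; rewrite inE.
by elim: s {nz} => [|x s IH]; rewrite ?big_nil // big_cons -IH /=; case: ifP;
  rewrite ?add0r.
Qed.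

(** The four vertices are arbitrary distinct elements, which keeps the membership
    tests symbolic. *)
Lemma small_network_tree_cost (p q z1 z2 : V) (a b c d m alpha : R) :
  uniq [:: p; q; z1; z2] ->
  0 < a -> 0 < b -> 0 < c -> 0 < d -> 0 < m -> 0 < alpha ->
  tree_cost
    (network_of [:: ([set p]%SET,      true,  ln a);
                    ([set q]%SET,      true,  ln c);
                    ([set p; q]%SET,   false, ln b);
                    ([set p; q]%SET,   true,  ln d);
                    ([set p; z1]%SET,  false, ln m);
                    ([set q; z1]%SET,  false, ln alpha);
                    ([set q; z2]%SET,  false, ln (m / alpha));
                    ([set z1; z2]%SET, false, ln m);
                    ([set z2]%SET,     true,  ln m)])
    (Node (Node (Node (Leaf p) (Leaf z1)) (Leaf q)) (Leaf z2)) =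
    a * b * d * alpha * m ^+ 2 + a * b * c * d * m ^+ 2 +
    a * c * d * m ^+ 3 / alpha.
Proof.
move=> dist; move: (dist); rewrite [uniq _]/= !inE !negb_or !andbT {dist}.
case/and3P=> /and3P[/negbTE pq /negbTE p1 /negbTE p2] /andP[/negbTE q1 /negbTE q2].
move=> /negbTE z12 a0 b0 c0 d0 m0 al0; rewrite /tree_cost.
have sym := (eq_sym q p, eq_sym z1 p, eq_sym z2 p, eq_sym z1 q, eq_sym z2 q,
             eq_sym z2 z1).
have neq := (pq, p1, p2, q1, q2, z12).
cbn [contractions cat leaves].
rewrite 3!big_cons big_nil addr0 addrA.
have dis (x y : V) (A : {set V}) : [disjoint A :|: [set x]%SET & [set y]%SET] =
    [disjoint A & [set y]%SET] && (x != y).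
  by rewrite -setI_eq0 setIUl setU_eq0 !setI_eq0 disjoints1 inE.
rewrite !network_of_cost;
  [ | first [ by rewrite /= -!card_gt0 ?cards1 ?cards2
            | by rewrite /= ?dis disjoints1 inE ?sym ?neq ] ..].
cbn [foldr fst snd].
rewrite /listed_crosses; cbn [fst snd].
rewrite !(meets_set1, meets_set2, sub_set2, sub1set, in_setU, in_set1).
rewrite ?sym ?eqxx ?neq /=.
rewrite !(addr0, add0r) !expRD !lnK ?posrE ?divr_gt0 //.
field.
by rewrite gt_eqF.
Qed.

Lemma matrix_tree_cost (v g : V) (x y z : R) : v != g ->
  tree_cost
    (network_of [:: ([set v]%SET,    true,  x);
                    ([set v; g]%SET, false, y);
                    ([set g]%SET,    true,  z)])
    (Node (Leaf v) (Leaf g)) = expR (x + (y + z)).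
Proof.
move=> /negbTE vg; rewrite /tree_cost; cbn [contractions cat leaves].
rewrite big_cons big_nil addr0 network_of_cost;
  [ | by rewrite /= -!card_gt0 ?cards1 ?cards2
    | by rewrite /= disjoints1 inE vg ].
cbn [foldr fst snd]; rewrite /listed_crosses; cbn [fst snd].
rewrite !meets_set1 !meets_set2 !sub_set2 !sub1set !inE.
by rewrite ?(eq_sym g v) ?eqxx ?vg /= addr0.
Qed.

End ConcreteNetworks.


Lemma small_network_costE (R : realType) (a b c d m alpha : R) :
  0 < a -> 0 < b -> 0 < c -> 0 < d -> 0 < m -> 0 < alpha ->
  small_network_cost m a b c d alpha =
    a * b * d * alpha * m ^+ 2 + a * b * c * d * m ^+ 2 +
    a * c * d * m ^+ 3 / alpha.
Proof. exact: small_network_tree_cost. Qed.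

(** * Upper bound on the cost of the algorithm *)

Section StepCost.
Variable R : realType.

(** Without the truncation, [alpha ^+ 2 = s * m / u] balances the two terms, and
    the bound is the inequality between arithmetic and geometric means.  If
    [alpha] is truncated to [1], then [s * m <= u], and if it is truncated to
    [m], then [u * m <= s]; in both cases the cost is at most twice
    [q * m ^+ 2]. *)
Lemma clamped_minimizer (u s q m theta : R) :
  0 < u -> 0 < s -> u <= q -> s <= q -> 1 <= m -> 0 < theta ->
  let alpha := Num.min m (Num.max 1 (Num.sqrt (s * m / u))) in
  u * alpha * m ^+ 2 + s * m ^+ 3 / alpha <=
    2 * q * m ^+ 2 + (u * theta * m ^+ 2 + s * m ^+ 3 / theta).
Proof.
move=> u0 s0 uq sq m1 th0 /=.
have m0 : 0 < m by lra.
have q0 : 0 < q by lra.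
set r := Num.sqrt _.
have r0 : 0 < r by rewrite sqrtr_gt0 divr_gt0 ?mulr_gt0.
have r2 : r ^+ 2 * u = s * m.
  by rewrite sqr_sqrtr ?ltW ?divr_gt0 ?mulr_gt0 // divfK ?gt_eqF.
have m2 : 0 < m ^+ 2 by rewrite exprn_gt0.
have th_ge0 : 0 <= u * theta * m ^+ 2 + s * m ^+ 3 / theta.
  by rewrite addr_ge0 ?divr_ge0 ?mulr_ge0 ?exprn_ge0 ?ltW.
have [r1|r1] := leP r 1.
  rewrite min_r // divr1 mulr1.
  have : s * m <= u by rewrite -r2 ler_piMl ?exprn_ile1 // ltW.
  nra.
have [rm|rm] := leP m r.
  have : u * m <= s.
    rewrite -(ler_pM2r m0) -r2 -mulrA [r ^+ 2 * u]mulrC ler_pM2l //.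
    by rewrite -expr2 ler_sqr ?nnegrE // ltW.
  have -> : s * m ^+ 3 / m = s * m ^+ 2 by field; rewrite gt_eqF.
  nra.
have -> : s * m ^+ 3 = r ^+ 2 * u * m ^+ 2 by rewrite r2; ring.
have -> : r ^+ 2 * u * m ^+ 2 / r = u * r * m ^+ 2 by field; rewrite gt_eqF.
have : u * m ^+ 2 * (2 * r) <= u * m ^+ 2 * (theta + r ^+ 2 / theta).
  rewrite ler_pM2l ?mulr_gt0 // -(ler_pM2r th0) [leRHS]mulrDl divfK ?gt_eqF //.
  by have := sqr_ge0 (theta - r); nra.
have -> : u * m ^+ 2 * (theta + r ^+ 2 / theta) =
  u * theta * m ^+ 2 + r ^+ 2 * u * m ^+ 2 / theta by ring.
have : 0 <= q * m ^+ 2 by rewrite mulr_ge0 ?ltW.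
by nra.
Qed.

Variables (VD ED : finType) (D : network R VD ED) (Ebar : {set ED}).
Hypothesis wfD : wf_network D.
Let cutR := cutR D Ebar.

Let ends_gt0 e : (0 < #|ends D e|)%N. Proof. by have [] := wfD e. Qed.
Let wt_ge0 e : 0 <= wt D e. Proof. by have [] := wfD e. Qed.

(** In terms of the sizes [a, b, c, d], the cut of [U] is [abd], that of [W] is
    [cbd], that of the union is [acd], and the data part of the cost of
    [(U, W)] is [abcd].  The algorithm branches on the smaller of the cuts of
    [U] and [W], so its bound holds with either of them. *)
Lemma contraction_step_upper (U W A : {set VD}) (m theta : R) :
  [disjoint U & W] -> 1 <= m -> 0 < theta -> A = U \/ A = W ->
  contraction_step_cost D Ebar m U W <=
    3 * expR (contraction_cost D (~: Ebar) U W) * m ^+ 2 +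
    (expR (cutR A) * theta * m ^+ 2 +
     expR (cutR (U :|: W)) * m ^+ 3 / theta).
Proof.
move=> dUW m1 th0 AUW; have m0 : 0 < m by lra.
rewrite /contraction_step_cost.
set a := size_a D Ebar U W; set b := size_b D Ebar U W.
set c := size_c D Ebar U W; set d := size_d D Ebar U W.
have a0 : 0 < a by exact: expR_gt0.
have c0 : 0 < c by exact: expR_gt0.
have d0 : 0 < d by rewrite divr_gt0 ?expR_gt0 ?mulr_gt0.
have b0 : 0 < b by rewrite divr_gt0 ?expR_gt0.
have Ebd : b * d = expR (cutR_between D Ebar U W).
  by rewrite /b /size_b divfK ?gt_eqF.
have Eacd : a * c * d = expR (cutR (U :|: W)).
  by rewrite /d /size_d mulrC divfK // gt_eqF // mulr_gt0.
have Eabd : a * (b * d) = expR (cutR U) by rewrite Ebd -expRD subrK.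
have Ecbd : c * (b * d) = expR (cutR W) by rewrite Ebd -expRD subrK.
have Eq : a * c * (b * d) = expR (contraction_cost D (~: Ebar) U W).
  rewrite Ebd -!expRD /contraction_cost -/(cutR_between D Ebar U W).
  by congr expR; rewrite -!/(Defs.cutR D Ebar _); ring.
have Uq : expR (cutR U) <= expR (contraction_cost D (~: Ebar) U W).
  by rewrite ler_expR cut_weight_le_cost.
have Wq : expR (cutR W) <= expR (contraction_cost D (~: Ebar) U W).
  by rewrite ler_expR contraction_costC cut_weight_le_cost // disjoint_sym.
have Sq : expR (cutR (U :|: W)) <= expR (contraction_cost D (~: Ebar) U W).
  by rewrite ler_expR cut_weight_setU_le_cost.
have al0 x : 0 < Num.min m (Num.max 1 x) by rewrite lt_min m0 lt_max ltr01.
have bd0 : 0 < b * d by rewrite mulr_gt0.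
have ratio x y : 0 < x -> y * m / b = x * y * d * m / (x * (b * d)).
  by move=> x0; field; rewrite !gt_eqF.
case: (leP a c) => ac; rewrite small_network_costE ?al0 //.
- have UA : expR (cutR U) <= expR (cutR A).
    by case: AUW => -> //; rewrite -Eabd -Ecbd ler_pM2r.
  have := clamped_minimizer (expR_gt0 (cutR U)) (expR_gt0 (cutR (U :|: W)))
    Uq Sq m1 th0.
  rewrite /best_alpha (ratio a c) // Eacd Eabd; set al := Num.min _ _.
  have -> : a * b * d * al * m ^+ 2 = expR (cutR U) * al * m ^+ 2.
    by rewrite -Eabd; ring.
  have -> : a * b * c * d * m ^+ 2 =
      expR (contraction_cost D (~: Ebar) U W) * m ^+ 2 by rewrite -Eq; ring.
  have : expR (cutR U) * theta * m ^+ 2 <= expR (cutR A) * theta * m ^+ 2.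
    by rewrite !ler_pM2r // exprn_gt0.
  by move=> *; lra.
- have WA : expR (cutR W) <= expR (cutR A).
    by case: AUW => -> //; rewrite -Eabd -Ecbd ler_pM2r // ltW.
  have := clamped_minimizer (expR_gt0 (cutR W)) (expR_gt0 (cutR (U :|: W)))
    Wq Sq m1 th0.
  rewrite /best_alpha (ratio c a) // [c * a]mulrC Eacd Ecbd; set al := Num.min _ _.
  have -> : c * b * d * al * m ^+ 2 = expR (cutR W) * al * m ^+ 2.
    by rewrite -Ecbd; ring.
  have -> : c * b * a * d * m ^+ 2 =
      expR (contraction_cost D (~: Ebar) U W) * m ^+ 2 by rewrite -Eq; ring.
  have : expR (cutR W) * theta * m ^+ 2 <= expR (cutR A) * theta * m ^+ 2.
    by rewrite !ler_pM2r // exprn_gt0.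
  by move=> *; lra.
Qed.

Lemma matrix_step_costE (m : R) (e : ED) : 0 < m ->
  matrix_step_cost D Ebar m e = expR (cutR (ends D e) + wt D e) * m.
Proof.
move=> m0; rewrite /matrix_step_cost matrix_tree_cost //.
by rewrite addrA [LHS]expRD lnK ?posrE.
Qed.

End StepCost.

(** * Charging the algorithm to a constrained contraction tree *)

(** The operands are the entries of the duplicate-free list [nodes T] other than
    its root, and the results are those other than its leaves. *)
Lemma count_contraction_sets (V : finType) (T : ctree V) (S : {set V}) :
  ctree_disjoint T ->
  (count (fun c => c.1 == S) (contractions T) +
     count (fun c => c.2 == S) (contractions T) <= 1 /\
   count (fun c => c.1 :|: c.2 == S) (contractions T) <= 1)%N.
Proof.
move=> /nodes_uniq u; have le1 : (count (pred1 S) (nodes T) <= 1)%N.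
  by rewrite (count_uniq_mem _ u) leq_b1.
split; last exact: leq_trans (count_unions (pred1 S) T) _.
by apply: leq_trans le1; rewrite count_nodes leq_addl.
Qed.

Lemma sum_bool_count (I : Type) (P : pred I) (r : seq I) :
  \sum_(i <- r) nat_of_bool (P i) = count P r.
Proof.
by rewrite -sum1_count [RHS]big_mkcond; apply: eq_bigr => i _; case: (P i).
Qed.

Section Charging.
Variables (R : realType) (I J : eqType).

Lemma ler_charge (s : seq J) (f : J -> R) (n : J -> nat) (j : J) (x : R) :
  (forall j, 0 <= f j) -> j \in s -> (0 < n j)%N -> x <= f j ->
  x <= \sum_(j <- s) f j * (n j)%:R.
Proof.
move=> f0 js nj xf; rewrite (big_rem j) //=; apply: ler_wpDr.
  by apply: sumr_ge0 => i _; rewrite mulr_ge0.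
by apply: le_trans xf _; rewrite ler_peMr // ler1n.
Qed.

Lemma sum_charges (r : seq I) (P : pred I) (s : seq J) (f : J -> R)
    (n : I -> J -> nat) (N : nat) :
  (forall j, 0 <= f j) -> (forall j, (\sum_(i <- r | P i) n i j <= N)%N) ->
  \sum_(i <- r | P i) \sum_(j <- s) f j * (n i j)%:R <=
    N%:R * \sum_(j <- s) f j.
Proof.
move=> f0 nN; rewrite exchange_big mulr_sumr /=; apply: ler_sum => j _.
by rewrite -mulr_sumr -natr_sum mulrC ler_wpM2r // ler_nat.
Qed.

End Charging.

Section LowerBound.
Variables (R : realType) (VD ED VE F : finType).
Variables (D : network R VD ED) (Ebar : {set ED}) (Em : embedding R ED VE F).
Variable rk : (VD + VE)%type -> nat.
Hypothesis sk : sketchable D Ebar.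
Hypothesis cover : forall v : VD, exists2 e, e \in Ebar & v \in ends D e.
Hypothesis wfE : wf_embedding Em.
Hypothesis big_dims : {in Ebar, forall e, sketch_size Em < expR (wt D e)}.
Hypothesis rk_order : sketching_order rk.
Hypothesis rk_out : forall v : VE,
  ln (sketch_size Em) <= outgoing D Ebar Em rk (inr v).
Variables (T0 : ctree VD) (TB : ctree (VD + VE)%type).
Hypothesis T0_tree : is_contraction_tree T0.
Hypothesis TB_tree : is_contraction_tree TB.
Hypothesis TB_constrained : constrained T0 TB.
Variables (m kappa : R).
Hypothesis m1 : 1 <= m.
Hypothesis kappa1 : 1 <= kappa.
Hypothesis m_le : m <= kappa * sketch_size Em.

Let G := combined D Ebar Em.
Let M := sketch_size Em.
Let data (A : {set VD + VE}) : {set VD} := inl @^-1: A.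
Let step_cost (c : {set VD + VE} * {set VD + VE}) : R :=
  expR (contraction_cost G [set: ED + F]%SET c.1 c.2).

(** How often the contraction [c] may be used to pay for the data contraction
    [p]: because it lies over [p], because it creates one of the operands lying
    over those of [p], or because it consumes the result lying over that of
    [p].  All this is read off the traces on the data. *)
Definition charge (p : {set VD} * {set VD})
    (c : {set VD + VE} * {set VD + VE}) : nat :=
  ((p.1 :|: p.2 == data (c.1 :|: c.2)) +
   ((p.1 == data (c.1 :|: c.2)) + (p.2 == data (c.1 :|: c.2))) +
   ((p.1 :|: p.2 == data c.1) + (p.1 :|: p.2 == data c.2)))%N.

Lemma sum_charge c : (\sum_(p <- contractions T0) charge p c <= 4)%N.
Proof.
have [dis _] := T0_tree.
rewrite /charge !big_split /= !sum_bool_count.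
have [_ H1] := count_contraction_sets (data (c.1 :|: c.2)) dis.
have [H2 _] := count_contraction_sets (data (c.1 :|: c.2)) dis.
have [_ H3] := count_contraction_sets (data c.1) dis.
have [_ H4] := count_contraction_sets (data c.2) dis.
exact: leq_add (leq_add H1 H2) (leq_add H3 H4).
Qed.

Let M0 : 0 < M. Proof. exact: expR_gt0. Qed.

Let expR_ln_M : expR (ln M) = M. Proof. by rewrite lnK ?posrE. Qed.

Let step_cost_ge0 c : 0 <= step_cost c. Proof. exact: expR_ge0. Qed.

(** The lower bounds for [theta = expR t] are compared with the upper bound at the
    same [theta].  The factor [5] adds the coefficients [3], [1] and [1] of the
    three terms of [contraction_step_upper]. *)
Lemma contraction_step_charge p : p \in contractions T0 ->
  contraction_step_cost D Ebar m p.1 p.2 <=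
    5 * kappa ^+ 3 * \sum_(c <- contractions TB) step_cost c * (charge p c)%:R.
Proof.
case: p => U W pT0 /=; set Q := \sum_(c <- _) _.
have [dis leavesT] := T0_tree.
have [U0 W0 _] := contraction_nodes pT0.
have {}U0 := node_neq0 U0; have {}W0 := node_neq0 W0.
have dUW : [disjoint U & W] by exact: (allP dis _ pT0).
have [wfD _ _] := sk.
have [c cT traces] := TB_constrained pT0.
have [UW costUW d1 d2 sides] : [/\ data (c.1 :|: c.2) = U :|: W,
    contraction_cost D (~: Ebar) (data c.1) (data c.2) =
      contraction_cost D (~: Ebar) U W, data c.1 != set0, data c.2 != set0 &
    forall Y, Y = c.1 \/ Y = c.2 -> data Y = U \/ data Y = W].
  rewrite /data preimsetU; case: traces => -[e1 e2]; rewrite e1 e2; split=> //.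
  - by move=> Y [] ->; [left | right].
  - by rewrite setUC.
  - by rewrite contraction_costC.
  - by move=> Y [] ->; [right | left].
have chargeQ c' x : c' \in contractions TB -> (0 < charge (U, W) c')%N ->
    x <= contraction_cost G [set: ED + F]%SET c'.1 c'.2 -> expR x <= Q.
  by move=> c'T pos xc; apply: ler_charge c'T pos _ => //; rewrite ler_expR.
have baseQ x : x <= contraction_cost D (~: Ebar) U W + (ln M + ln M) ->
    expR x <= Q.
  move=> xc; apply: (chargeQ c) => //; first by rewrite /charge UW eqxx.
  apply: le_trans xc _; rewrite -costUW.
  exact: (cost_lower_bound sk cover wfE big_dims rk_order rk_out TB_tree cT).
have [t [Y [Yc low high]]] :=
  tradeoff sk cover wfE big_dims rk_order rk_out TB_tree cT d1 d2.
have YUW := sides Y Yc.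
have ends0 e : (0 < #|ends D e|)%N by have [] := wfD e.
have wt0 e : 0 <= wt D e by have [] := wfD e.
have H1 : expR (contraction_cost D (~: Ebar) U W) * M ^+ 2 <= Q.
  by rewrite -[M]expR_ln_M expr2 -!expRD baseQ.
have H2 : expR (cutR D Ebar (data Y)) * expR t * M ^+ 2 <= Q.
  rewrite -[M]expR_ln_M expr2 -!expRD.
  case: low => [t0|[c' c'T [c'Y le]]].
    apply: baseQ; rewrite t0 addr0 lerD2r.
    case: YUW => ->; first by apply: cut_weight_le_cost.
    by rewrite contraction_costC; apply: cut_weight_le_cost; rewrite // disjoint_sym.
  apply: (chargeQ c') => //.
    by rewrite /charge /= c'Y !addn_gt0 !lt0b; case: YUW => ->; rewrite eqxx ?orbT.
  by apply: le_trans le; rewrite -/M; lra.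
have H3 : expR (cutR D Ebar (U :|: W)) * M ^+ 3 / expR t <= Q.
  rewrite -[M]expR_ln_M !exprS expr0 mulr1 -expRN -!expRD.
  case: high => [tM|[c' c'T [c'Z le]]].
    apply: baseQ.
    have : cutR D Ebar (U :|: W) <= contraction_cost D (~: Ebar) U W.
      exact: cut_weight_setU_le_cost.
    by rewrite -/M in tM *; lra.
  apply: (chargeQ c') => //.
    rewrite /charge /= -UW !addn_gt0 !lt0b.
    by case/orP: c'Z => /eqP ->; rewrite eqxx ?orbT.
  by apply: le_trans le; rewrite -/M (UW : inl @^-1: _ = _); lra.
have := contraction_step_upper Ebar wfD dUW m1 (expR_gt0 t) YUW.
move/le_trans; apply.
have m0 : 0 <= m by apply: le_trans m1.
have k0 : 0 <= kappa by apply: le_trans kappa1.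
have m2 : m ^+ 2 <= kappa ^+ 3 * M ^+ 2.
  apply: le_trans (_ : (kappa * M) ^+ 2 <= _).
    by rewrite lerXn2r ?nnegrE // mulr_ge0 // ltW.
  by rewrite exprMn ler_wpM2r ?sqr_ge0 // ler_weXn2l.
have m3 : m ^+ 3 <= kappa ^+ 3 * M ^+ 3.
  by rewrite -exprMn lerXn2r ?nnegrE // mulr_ge0 // ltW.
have scale (x y z : R) : 0 <= x -> y <= kappa ^+ 3 * z -> x * z <= Q ->
    x * y <= kappa ^+ 3 * Q.
  move=> x0 yz xz; apply: le_trans (ler_wpM2l x0 yz) _.
  by rewrite mulrCA ler_wpM2l // exprn_ge0.
have := scale _ _ _ (expR_ge0 _) m2 H1.
have := scale _ _ _ (mulr_ge0 (expR_ge0 _) (expR_ge0 _)) m2 H2.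
have H3' : expR (cutR D Ebar (U :|: W)) / expR t * M ^+ 3 <= Q.
  by apply: le_trans H3; rewrite mulrAC.
have := scale _ _ _ (divr_ge0 (expR_ge0 _) (expR_ge0 _)) m3 H3'.
by rewrite mulrAC => *; lra.
Qed.

Lemma matrix_step_charge e : e \in Ebar ->
  matrix_step_cost D Ebar m e <=
    kappa * \sum_(c <- contractions TB) step_cost c *
      ((inl @: ends D e == c.1) + (inl @: ends D e == c.2))%:R.
Proof.
move=> eE; have m0 : 0 < m by apply: lt_le_trans m1.
have [c cT [cv le]] :=
  matrix_lower_bound sk cover wfE big_dims rk_order rk_out TB_tree eE.
rewrite matrix_step_costE //.
apply: le_trans (_ : expR (cutR D Ebar (ends D e) + wt D e) * (kappa * M) <= _).
  by rewrite ler_wpM2l ?expR_ge0.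
rewrite mulrCA ler_wpM2l //; first by apply: le_trans kappa1.
rewrite -[M]expR_ln_M -expRD; apply: (ler_charge _ cT) => //.
  by rewrite addn_gt0 !lt0b ![_ @: _ == _]eq_sym.
by rewrite ler_expR -addrA.
Qed.

Lemma sum_matrix_charge (c : {set VD + VE} * {set VD + VE}) :
  (\sum_(e in Ebar) ((inl @: ends D e == c.1) + (inl @: ends D e == c.2)) <= 2)%N.
Proof.
have one (Z : {set VD + VE}) : (\sum_(e in Ebar) (inl @: ends D e == Z) <= 1)%N.
  have [_ _ inj] := sk.
  rewrite -[leqLHS]big_mkcondr /= sum1dep_card; apply/card_le1_eqP => e e'.
  rewrite !inE => /andP[eE /eqP eZ] /andP[e'E /eqP]; rewrite -eZ.
  have inl_inj : injective (@inl VD VE) by move=> x y [].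
  by move=> /(imset_inj inl_inj) ee'; apply: inj => //; rewrite ee'.
by rewrite big_split /= (leq_add (one c.1) (one c.2)).
Qed.

(** Each contraction of [TB] is charged at most [4] times at the rate [5] by the
    contractions of [T0] and at most [2] times at the rate [1] by the edges to be
    sketched, hence [22 = 5 * 4 + 2]. *)
Lemma algorithm_le_tree_cost :
  algorithm_cost D Ebar m T0 <= 22 * kappa ^+ 3 * tree_cost G TB.
Proof.
have k0 : 0 <= kappa by apply: le_trans kappa1.
have S0 : 0 <= tree_cost G TB by apply: sumr_ge0 => c _; exact: expR_ge0.
have H1 : \sum_(e in Ebar) matrix_step_cost D Ebar m e <=
    kappa * (2 * tree_cost G TB).
  apply: le_trans (ler_sum _ matrix_step_charge) _.
  rewrite -mulr_sumr ler_wpM2l //.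
  exact: (sum_charges _ step_cost_ge0 sum_matrix_charge).
have H2 : \sum_(c <- contractions T0) contraction_step_cost D Ebar m c.1 c.2 <=
    5 * kappa ^+ 3 * (4 * tree_cost G TB).
  rewrite big_seq.
  apply: le_trans (ler_sum _ contraction_step_charge) _.
  rewrite -big_seq -mulr_sumr ler_wpM2l ?mulr_ge0 ?exprn_ge0 //.
  exact: (sum_charges _ step_cost_ge0 sum_charge).
have kk : kappa * tree_cost G TB <= kappa ^+ 3 * tree_cost G TB.
  by rewrite ler_wpM2r // -{1}[kappa]expr1 ler_weXn2l.
by rewrite /algorithm_cost; lra.
Qed.

End LowerBound.

(* lo1, up1 : constants of m = Theta(N log(1/delta)/eps^2) in the algorithm;
   lo2, up2 : constants of m = Theta(N_E log(1/delta)/eps^2) in the class. *)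
Theorem theorem4p1 (R : realType) (lo1 up1 lo2 up2 k : R)
    (hlo1 : 0 < lo1) (hup1 : 0 < up1) (hlo2 : 0 < lo2) (hup2 : 0 < up2)
    (hk : 0 < k) :
  exists2 K : R, 0 < K &
    forall (VD ED : finType) (D : network R VD ED) (Ebar : {set ED})
           (T0 : ctree VD) (eps delta m : R),
      sketchable D Ebar ->
      (forall v : VD, exists2 e, e \in Ebar & v \in ends D e) ->
      is_contraction_tree T0 ->
      0 < eps -> 0 < delta < 1 ->
      1 <= m ->
      theta lo1 up1 m (#|Ebar|%:R * ln (1 / delta) / eps ^+ 2) ->
      {in Ebar, forall e, m < expR (wt D e)} ->
      ((algorithm_cost D Ebar m T0)%:E <=
         K%:E * optimal_cost lo2 up2 k eps delta m D Ebar T0)%E.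
Proof.
have kappa1 : 1 <= Num.max 1 k by rewrite le_max lexx.
have K0 : 0 < 22 * Num.max 1 k ^+ 3.
  by rewrite mulr_gt0 // exprn_gt0 // (lt_le_trans _ kappa1).
exists (22 * Num.max 1 k ^+ 3) => // VD ED D Ebar T0 eps delta m sk cover T0_tree.
move=> _ _ m1 _ _; rewrite -lee_pdivrMl //.
apply: le_ereal_inf_tmp => x [VE [F [Em [TB []]]]].
move=> [[wfE _ _ [rk [rk_order rk_out]]] big_dims] mk TB_tree TBc -> {x}.
rewrite lee_pdivrMl // -EFinM lee_fin.
apply: (algorithm_le_tree_cost sk cover wfE big_dims rk_order rk_out
  T0_tree TB_tree TBc m1 kappa1).
apply: le_trans mk _; rewrite ler_wpM2r ?expR_ge0 //.
by rewrite le_max lexx orbT.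
Qed.
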